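(* Let $S_{\lambda}\in\mathcal{B}(\ell^2(V))$ be a quasi-$\ast$-paranormal weighted shift on $\ell^2(V)$ with weights $(\lambda_v)_{v\in V^0}$. Then for every $f\in\ell^2(V)$, $$\left(\sum_{u\in V} \|S_{\lambda}e_u\|^4|f(u)|^2\right)^2 \leq \left(\sum_{u\in V}\|S_{\lambda}^3e_u\|^2 |f(u)|^2\right)\left(\sum_{u\in V} \|S_{\lambda}e_u\|^2 |f(u)|^2\right).$$
   Context: $G=(V,E)$ is a directed graph in which every vertex $v$ has at most one parent: $(u,v)\in E\subset V\times V$ means $u=par(v)$ is the parent of $v$, and $v$ is a child of $u$. A vertex with no parent is a root, and $V^0$ is $V$ minus the set of roots. $\ell^2(V)$ is the Hilbert space of square summable complex functions on $V$ with orthonormal basis $\{e_u\}_{u\in V}$, $e_u(v)=1$ if $v=u$ and $0$ otherwise. For complex weights $(\lambda_v)_{v\in V^0}$, the weighted shift $S_\lambda$ is given by $(S_\lambda f)(v)=\lambda_v f(par(v))$ if $v$ is not a root and $(S_\lambda f)(v)=0$ if $v$ is a root. $\mathcal{B}(\mathcal{H})$ denotes the bounded linear operators on a Hilbert space $\mathcal{H}$. An operator $T\in\mathcal{B}(\mathcal{H})$ is quasi-$\ast$-paranormal if $\|T^*Tx\|^2\le\|T^3x\|\,\|Tx\|$ for all $x\in\mathcal{H}$. *)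

(* Defs.v *)
From HB Require Import structures.
From mathcomp Require Import all_boot all_order all_algebra complex ring lra.
From mathcomp Require Import all_classical all_reals all_analysis.

Set Implicit Arguments.
Unset Strict Implicit.
Unset Printing Implicit Defensive.

Import Order.TTheory GRing.Theory Num.Theory.

Local Open Scope classical_set_scope.
Local Open Scope complex_scope.
Local Open Scope ring_scope.

Section square_summable.
Variables (R : realType) (V : choiceType).
Implicit Types f g : V -> R[i].

(* [Normc.normc] is the modulus as an element of [R]; the generic norm [`|z|]
   is an element of [R[i]]. *)
Definition sqnorm f : \bar R :=
  \esum_(v in [set: V]) ((Normc.normc (f v)) ^+ 2)%:E.

Definition square_summable : {pred V -> R[i]} :=
  [pred f | (sqnorm f < +oo)%E].

Lemma sqnorm_ge0 f : (0 <= sqnorm f)%E.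
Proof. by apply: esum_ge0 => v _; rewrite lee_fin sqr_ge0. Qed.

Lemma sqr_normcD (x y : R[i]) :
  (Normc.normc (x + y)) ^+ 2 <=
  (Normc.normc x) ^+ 2 + (Normc.normc x) ^+ 2
  + ((Normc.normc y) ^+ 2 + (Normc.normc y) ^+ 2).
Proof.
have h0 (z : R[i]) : 0 <= Normc.normc z by case: z => a b; exact: sqrtr_ge0.
have := @le_normcD R x y; have := h0 (x + y).
move: (Normc.normc _) (Normc.normc x) (Normc.normc y) => c a b c0 cab.
apply: (@le_trans _ _ ((a + b) ^+ 2)).
  by rewrite ler_sqr ?nnegrE // (le_trans c0).
by have := sqr_ge0 (a - b); lra.
Qed.

Lemma sqnormZ_le (a : R[i]) f :
  (sqnorm (a *: f) <= ((Normc.normc a) ^+ 2)%:E * sqnorm f)%E.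
Proof.
apply: ge_ereal_sup => _ [A [finA _] <-].
rewrite (_ : (\sum_(x \in A) _)%R = ((Normc.normc a) ^+ 2)%:E *
   (\sum_(x \in A) ((Normc.normc (f x)) ^+ 2)%:E)%R)%E; last first.
  rewrite ge0_mule_fsumr; last by move=> i; rewrite lee_fin sqr_ge0.
  by apply: eq_fsbigr => v _; rewrite -EFinM -exprMn -Normc.normcM.
by apply: lee_wpmul2l; [rewrite lee_fin sqr_ge0|apply: esum_ge; exists A].
Qed.

Lemma square_summable_submod_closed : submod_closed square_summable.
Proof.
split.
  rewrite inE /sqnorm esum1 ?ltry // => v _.
  by rewrite (_ : (0 : V -> R[i]) v = 0) // Normc.normc0 expr0n.
move=> a f g; rewrite !inE => hf hg.
apply: (@le_lt_trans _ _
  ((sqnorm (a *: f) + sqnorm (a *: f)) + (sqnorm g + sqnorm g))%E).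
  have nn h (v : V) : (0 <= ((Normc.normc (h v)) ^+ 2)%:E :> \bar R)%E.
    by rewrite lee_fin sqr_ge0.
  rewrite /sqnorm -!esumD; do ?by move=> v _; rewrite ?adde_ge0 ?nn.
  by apply: le_esum => v _; rewrite -!EFinD lee_fin; exact: sqr_normcD.
suff haf : (sqnorm (a *: f) < +oo)%E by rewrite !lte_add_pinfty.
apply: (le_lt_trans (sqnormZ_le a f)).
by rewrite lte_mul_pinfty // lee_fin sqr_ge0.
Qed.

HB.instance Definition _ := GRing.isSubmodClosed.Build _ _ square_summable
  square_summable_submod_closed.

End square_summable.

Record l2 (R : realType) (V : choiceType) := L2 {
  l2_fun :> V -> R[i];
  l2_funP : l2_fun \in @square_summable R V
}.

HB.instance Definition _ (R : realType) (V : choiceType) :=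
  [isSub for @l2_fun R V].
HB.instance Definition _ (R : realType) (V : choiceType) :=
  [Choice of l2 R V by <:].
HB.instance Definition _ (R : realType) (V : choiceType) :=
  [SubChoice_isSubLmodule of l2 R V by <:].

Section hilbert_structure.
Variables (R : realType) (V : choiceType).

Definition l2norm (f : l2 R V) : R := Num.sqrt (fine (sqnorm f)).

(* Unordered sums over [V] of absolutely summable real, resp. complex,
   families: differences of the sums of positive and negative parts, resp.
   sums of real and imaginary parts. They are only used for the pointwise
   product of two square summable functions, which is absolutely summable. *)
Definition rsum (x : V -> R) : R :=
  fine (\esum_(v in [set: V]) (x^\+ v)%:E)
  - fine (\esum_(v in [set: V]) (x^\- v)%:E).

Definition csum (z : V -> R[i]) : R[i] :=
  rsum (fun v => complex.Re (z v)) +i* rsum (fun v => complex.Im (z v)).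

Definition l2dot (f g : l2 R V) : R[i] := csum (fun v => f v * (g v)^*).

Definition delta (u : V) : V -> R[i] := fun v => (v == u)%:R.

Lemma delta_square_summable u : delta u \in @square_summable R V.
Proof.
rewrite inE /sqnorm (esumID [set u]); last first.
  by move=> v _; rewrite lee_fin sqr_ge0.
rewrite setTI esum_set1 ?lee_fin ?sqr_ge0 // esum1 ?adde0 ?ltry //.
move=> v [_ /= /eqP /negbTE vu].
by rewrite /delta vu Normc.normc0 expr0n.
Qed.

Definition l2_basis (u : V) : l2 R V := L2 (delta_square_summable u).

End hilbert_structure.

Arguments l2_basis {R V} u.

Section operators.
Variables (R : realType) (V : choiceType).

Definition bounded_operator (T : {linear l2 R V -> l2 R V}) :=
  exists M : R, forall x, l2norm (T x) <= M * l2norm x.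

(* [adjoint T y] is the vector [z], unique if it exists, such that
   <T x, y> = <x, z> for all [x]. It exists for bounded [T] by the Riesz
   representation theorem; 0 is only a default value. *)
Definition adjoint (T : l2 R V -> l2 R V) (y : l2 R V) : l2 R V :=
  xget 0 [set z | forall x, l2dot (T x) y = l2dot x z].

Definition quasi_star_paranormal (T : {linear l2 R V -> l2 R V}) :=
  forall x, (l2norm (adjoint T (T x))) ^+ 2 <=
            l2norm (iter 3 T x) * l2norm (T x).

End operators.

Section weighted_shift.
Variables (R : realType) (V : choiceType) (E : set (V * V)).

Definition at_most_one_parent :=
  forall u u' v, E (u, v) -> E (u', v) -> u = u'.

Definition is_root (v : V) : Prop := ~ exists u, E (u, v).

(* The default value [v] is only returned when [v] is a root. *)
Definition parent (v : V) : V := xget v [set u | E (u, v)].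

(* Only the weights at vertices which are not roots are used. *)
Definition shift_fun (lambda : V -> R[i]) (f : V -> R[i]) (v : V) : R[i] :=
  if `[< is_root v >] then 0 else lambda v * f (parent v).

Definition is_weighted_shift (lambda : V -> R[i])
    (S : {linear l2 R V -> l2 R V}) :=
  forall (f : l2 R V) (v : V), S f v = shift_fun lambda f v.

End weighted_shift.

(* Main.v *)
(** The map [S] is a weighted composition operator [f v |-> mu v * f (p v)]
    ([p] the parent map, [mu] vanishing at the roots), and such operators are
    closed under composition. Summing over the fibers of [p], every such [T]
    satisfies [||T f||^2 = \sum_u ||T e_u||^2 |f u|^2], which applies to [S] and
    [S^3]. The same summation shows that [T^* T] is multiplication by
    [u |-> ||T e_u||^2], so [||S^* S f||^2 = \sum_u ||S e_u||^4 |f u|^2] and the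
    inequality is the square of the quasi-*-paranormality of [S] at [f]. *)

Require Import Defs.
From mathcomp Require Import all_boot all_order all_algebra complex.
From mathcomp Require Import all_classical all_reals all_analysis.

Import Order.TTheory GRing.Theory Num.Theory.

Local Open Scope classical_set_scope.
Local Open Scope ring_scope.

Section unordered_sums.
Context {R : realType}.

Lemma esumZl (T : choiceType) (D : set T) (c : R) (a : T -> \bar R) :
  0 <= c -> (forall i, (0 <= a i)%E) ->
  \esum_(i in D) (c%:E * a i)%E = (c%:E * \esum_(i in D) a i)%E.
Proof.
move=> c0 a0; rewrite /esum -ereal_supZl //; last first.
  (* A scalar passes through a supremum over a nonempty set; the empty sum is a member. *)
  by apply/set0P; exists (\sum_(i \in set0) a i)%R, set0 => //; exact: fsets_set0.
congr ereal_sup; rewrite image_comp; apply: eq_imagel => A _ /=.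
by rewrite ge0_mule_fsumr.
Qed.

(** The map [i |-> (p i, i)] is a bijection onto the disjoint union of the fibers, and nonnegative
    terms may be regrouped freely. *)
Lemma esum_fibers (T U : choiceType) (p : T -> U) (a : T -> \bar R) :
  (forall i, (0 <= a i)%E) ->
  \esum_(i in [set: T]) a i =
  \esum_(j in [set: U]) \esum_(i in p @^-1` [set j]) a i.
Proof.
move=> a0; rewrite esum_esum //.
rewrite (@reindex_esum _ _ _ setT _ (fun i => (p i, i)) (fun k => a k.2)) //.
split => //=; first by move=> i j _ _ [].
by move=> [u i] [_ /= <-]; exists i.
Qed.

Lemma esum_support1 (T : choiceType) (i : T) (a : T -> \bar R) :
  (forall j, (0 <= a j)%E) -> (forall j, j != i -> a j = 0%E) ->
  \esum_(j in [set: T]) a j = a i.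
Proof.
move=> a0 ai; rewrite (esumID [set i]) // setTI esum_set1 // esum1 ?adde0 //.
by move=> j [_ /= /eqP]; exact: ai.
Qed.

Lemma rsum_support1 (V : choiceType) (u : V) (x : V -> R) :
  (forall v, v != u -> x v = 0) -> rsum x = x u.
Proof.
move=> xu; rewrite /rsum !(@esum_support1 _ u).
- by rewrite /= -[in RHS](funrposBneg x).
- by move=> v; rewrite lee_fin funrneg_ge0.
- by move=> v /xu; rewrite /funrneg => ->; rewrite oppr0 maxxx.
- by move=> v; rewrite lee_fin funrpos_ge0.
- by move=> v /xu; rewrite /funrpos => ->; rewrite maxxx.
Qed.

End unordered_sums.

Section square_summable_functions.
Context {R : realType} {V : choiceType}.
Implicit Types (f g : l2 R V) (u v : V).

Lemma sqnorm_l2norm f : sqnorm f = (l2norm f ^+ 2)%:E.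
Proof.
have f0 := sqnorm_ge0 f; have := l2_funP f; rewrite inE => foo.
have ff : sqnorm f \is a fin_num by rewrite ge0_fin_numE.
by rewrite sqr_sqrtr ?fineK // fine_ge0.
Qed.

Lemma l2norm_basis u : l2norm (l2_basis u : l2 R V) = 1.
Proof.
rewrite /l2norm /sqnorm (@esum_support1 _ _ u).
- by rewrite /= /delta eqxx Normc.normc1 expr1n sqrtr1.
- by move=> v; rewrite lee_fin sqr_ge0.
- by move=> v /negbTE vu; rewrite /= /delta vu Normc.normc0 expr0n.
Qed.

Lemma l2dot_basis u g : l2dot (l2_basis u) g = (g u)^*.
Proof.
rewrite /l2dot /csum !(@rsum_support1 _ _ u).
- by rewrite /= /delta eqxx mul1r; case: (_^*).
- by move=> v /negbTE vu; rewrite /= /delta vu mul0r.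
- by move=> v /negbTE vu; rewrite /= /delta vu mul0r.
Qed.

(** Pairing with [l2_basis u] recovers the conjugate of the coordinate at [u]. This gives uniqueness
    of the adjoint. *)
Lemma l2dot_inj g g' : (forall x, l2dot x g = l2dot x g') -> g =1 g'.
Proof.
move=> h u; apply: (can_inj (@conjCK _)).
by have := h (l2_basis u); rewrite !l2dot_basis.
Qed.

End square_summable_functions.

Section weighted_compositions.
Context {R : realType} {V : choiceType}.
Implicit Types (mu : V -> R[i]) (p : V -> V) (T : l2 R V -> l2 R V).

(* Roots need no special treatment: there [mu] vanishes and [p] is arbitrary. *)
Definition weighted_composition mu p T :=
  forall f v, T f v = mu v * f (p v).

Lemma weighted_composition_comp mu p T nu q T' :
  weighted_composition mu p T -> weighted_composition nu q T' ->
  weighted_composition (fun v => mu v * nu (p v)) (q \o p) (T \o T').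
Proof. by move=> hT hT' f v; rewrite /= hT hT' mulrA. Qed.

(** On the fiber of [p] over [u] the factor [g (p v)] is the constant [g u], and [T e_u] is [mu] cut
    off to that fiber, so the remaining weights add up to its squared norm. *)
Lemma esum_weighted_composition {mu p T} (g : V -> R) :
  weighted_composition mu p T -> (forall v, 0 <= g v) ->
  \esum_(v in [set: V]) (Normc.normc (mu v) ^+ 2 * g (p v))%:E =
  \esum_(u in [set: V]) (l2norm (T (l2_basis u)) ^+ 2 * g u)%:E.
Proof.
move=> hT g0; rewrite [LHS](esum_fibers _ _ p); last first.
  by move=> v; rewrite lee_fin mulr_ge0 ?sqr_ge0.
apply: eq_esum => u _; rewrite [in RHS]mulrC EFinM -sqnorm_l2norm -esumZl //; last first.
  by move=> v; rewrite lee_fin sqr_ge0.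
rewrite esum_mkcond; apply: eq_esum => v _.
rewrite hT /= /delta; case: ifPn => [/set_mem/= ->|].
  by rewrite eqxx mulr1 mulrC.
rewrite notin_setE /= => /eqP/negbTE ->.
by rewrite mulr0 Normc.normc0 expr0n mule0.
Qed.

Lemma sqnorm_weighted_composition {mu p T} (f : l2 R V) :
  weighted_composition mu p T ->
  sqnorm (T f) = \esum_(u in [set: V])
    (l2norm (T (l2_basis u)) ^+ 2 * Normc.normc (f u) ^+ 2)%:E.
Proof.
move=> hT; rewrite -(esum_weighted_composition _ hT); last first.
  by move=> v; rewrite sqr_ge0.
by apply: eq_esum => v _; rewrite hT Normc.normcM exprMn.
Qed.

(** Nonnegative weights commute with taking positive and negative parts, so the nonnegative case
    applies to each part. *)
Lemma rsum_weighted_composition {mu p T} (x : V -> R) :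
  weighted_composition mu p T ->
  rsum (fun v => Normc.normc (mu v) ^+ 2 * x (p v)) =
  rsum (fun u => l2norm (T (l2_basis u)) ^+ 2 * x u).
Proof.
move=> hT.
have posM (a b : R) : 0 <= a -> Num.max (a * b) 0 = a * Num.max b 0.
  by move=> a0; rewrite maxr_pMr // mulr0.
rewrite /rsum /funrpos /funrneg; congr (fine _ - fine _).
- under eq_esum do rewrite posM ?sqr_ge0 //.
  under [RHS]eq_esum do rewrite posM ?sqr_ge0 //.
  apply: (esum_weighted_composition (fun u => Num.max (x u) 0) hT) => v.
  by rewrite le_max lexx orbT.
- under eq_esum do rewrite -mulrN posM ?sqr_ge0 //.
  under [RHS]eq_esum do rewrite -mulrN posM ?sqr_ge0 //.
  apply: (esum_weighted_composition (fun u => Num.max (- x u) 0) hT) => v.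
  by rewrite le_max lexx orbT.
Qed.


Lemma Re_realM (a : R) (z : R[i]) : complex.Re (a%:C%C * z) = a * complex.Re z.
Proof. by case: z => x y /=; rewrite mul0r subr0. Qed.

Lemma Im_realM (a : R) (z : R[i]) : complex.Im (a%:C%C * z) = a * complex.Im z.
Proof. by case: z => x y /=; rewrite mul0r addr0. Qed.

Lemma mul_conj_normc (z : R[i]) : z * z^* = (Normc.normc z ^+ 2)%:C%C.
Proof. by rewrite -normCK rmorphXn. Qed.

Lemma bounded_weights_square_summable (b : V -> R) (M : R) (f : l2 R V) :
  (forall u, 0 <= b u <= M) ->
  (fun u => (b u)%:C%C * f u) \in @square_summable R V.
Proof.
move=> hb; rewrite inE.
apply: (@le_lt_trans _ _ ((M ^+ 2)%:E * sqnorm f)%E); last first.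
  by rewrite sqnorm_l2norm ltry.
rewrite -esumZl ?sqr_ge0 //; last by move=> v; rewrite lee_fin sqr_ge0.
apply: le_esum => u _; have /andP[b0 bM] := hb u.
rewrite -EFinM lee_fin Normc.normcM exprMn ler_wpM2r ?sqr_ge0 //.
rewrite /= expr0n addr0 sqr_sqrtr ?sqr_ge0 //.
by rewrite ler_sqr ?nnegrE // (le_trans b0).
Qed.

(** This is the weak form of [T^* T] being a multiplication operator. The weights are real, so real
    and imaginary parts are summed over fibers separately. *)
Lemma l2dot_weighted_composition {mu p T} (f x z : l2 R V) :
  weighted_composition mu p T ->
  (forall u, z u = (l2norm (T (l2_basis u)) ^+ 2)%:C%C * f u) ->
  l2dot (T x) (T f) = l2dot x z.
Proof.
move=> hT hz.
have lhsE v : T x v * (T f v)^* =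
    (Normc.normc (mu v) ^+ 2)%:C%C * (x (p v) * (f (p v))^*).
  by rewrite !hT rmorphM mulrACA mul_conj_normc.
have rhsE u : x u * (z u)^* =
    (l2norm (T (l2_basis u)) ^+ 2)%:C%C * (x u * (f u)^*).
  rewrite hz rmorphM mulrCA; congr (_ * _).
  by apply/CrealP; rewrite complex_real.
rewrite /l2dot /csum.
congr Complex.
- under [X in rsum X]eq_fun do rewrite lhsE Re_realM.
  under [X in _ = rsum X]eq_fun do rewrite rhsE Re_realM.
  exact: (rsum_weighted_composition (fun u => complex.Re (x u * (f u)^*)) hT).
- under [X in rsum X]eq_fun do rewrite lhsE Im_realM.
  under [X in _ = rsum X]eq_fun do rewrite rhsE Im_realM.
  exact: (rsum_weighted_composition (fun u => complex.Im (x u * (f u)^*)) hT).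
Qed.

(* Boundedness of [T] puts the candidate value of the adjoint in [l2], which is
   what prevents [adjoint] from returning its default value. *)
Lemma adjoint_weighted_composition {mu p T} (M : R) (f : l2 R V) u :
  weighted_composition mu p T -> (forall x, l2norm (T x) <= M * l2norm x) ->
  adjoint T (T f) u = (l2norm (T (l2_basis u)) ^+ 2)%:C%C * f u.
Proof.
move=> hT hM; have hb v : 0 <= l2norm (T (l2_basis v)) ^+ 2 <= M ^+ 2.
  (* The multiplier is bounded by [M ^+ 2] because basis vectors have norm 1. *)
  have := hM (l2_basis v); rewrite l2norm_basis mulr1 sqr_ge0 => le_M.
  by rewrite ler_sqr ?nnegrE ?sqrtr_ge0 // (le_trans _ le_M) // sqrtr_ge0.
pose z := L2 (bounded_weights_square_summable _ _ f hb).
have zP x : l2dot (T x) (T f) = l2dot x z.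
  exact: l2dot_weighted_composition hT _.
(* [xget] returns some vector with the adjoint property; uniqueness identifies it with [z]. *)
rewrite -[RHS]/(z u); apply: l2dot_inj => x; rewrite -zP.
by rewrite /adjoint; case: xgetP => [w _ ->|/(_ z)].
Qed.

End weighted_compositions.

Lemma weighted_shift_composition {R : realType} {V : choiceType}
    {E : set (V * V)} {lambda : V -> R[i]} {S : {linear l2 R V -> l2 R V}} :
  is_weighted_shift E lambda S ->
  weighted_composition (fun v => if `[< is_root E v >] then 0 else lambda v)
    (parent E) S.
Proof. by move=> hS f v; rewrite hS /shift_fun; case: ifP; rewrite ?mul0r. Qed.

Theorem theorem3p1 (R : realType) (V : choiceType) (E : set (V * V))
    (hE : at_most_one_parent E) (lambda : V -> R[i])
    (S : {linear l2 R V -> l2 R V})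
    (hS : is_weighted_shift E lambda S)
    (hbounded : bounded_operator S)
    (hquasi : quasi_star_paranormal S)
    (f : l2 R V) :
  ((\esum_(u in [set: V])
      (l2norm (S (l2_basis u)) ^+ 4 * (Normc.normc (f u)) ^+ 2)%:E) ^+ 2
   <= (\esum_(u in [set: V])
         (l2norm (iter 3 S (l2_basis u)) ^+ 2 * (Normc.normc (f u)) ^+ 2)%:E)
    * (\esum_(u in [set: V])
         (l2norm (S (l2_basis u)) ^+ 2 * (Normc.normc (f u)) ^+ 2)%:E))%E.
Proof.
have hT := weighted_shift_composition hS.
(* The composite [S \o (S \o S)] is convertible to [iter 3 S]. *)
have hT3 := weighted_composition_comp _ _ _ _ _ _ hT
  (weighted_composition_comp _ _ _ _ _ _ hT hT).
have [M hM] := hbounded.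
rewrite -(sqnorm_weighted_composition f hT).
rewrite -(sqnorm_weighted_composition f hT3).
have -> : \esum_(u in [set: V])
    (l2norm (S (l2_basis u)) ^+ 4 * (Normc.normc (f u)) ^+ 2)%:E =
    sqnorm (adjoint S (S f)).
  apply: eq_esum => u _; rewrite (adjoint_weighted_composition M f u hT hM).
  rewrite Normc.normcM exprMn /= expr0n addr0 sqr_sqrtr ?sqr_ge0 //.
  by rewrite -exprM.
(* All three sums are now finite squared norms, so the inequality descends to the reals. *)
rewrite !sqnorm_l2norm -EFin_expe -EFinM lee_fin -exprMn.
by rewrite ler_sqr ?nnegrE ?sqr_ge0 ?mulr_ge0 ?sqrtr_ge0 //; exact: hquasi.
Qed.
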